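(* Let $n,L,d\ge 2$ be integers, let $E=\{e\subseteq [n]: |e|=L\}$ and $m=|E|$. Then the polynomial $$p_d(x)=\sum_{(e_1,\ldots,e_d)\in E^d}\frac{1}{|e_1\cup\cdots\cup e_d|}\,x_{e_1}\cdots x_{e_d}$$ in the variables $x=(x_e)_{e\in E}$ is convex on the standard simplex $\Delta_m$.
   Context: $[n]=\{1,\ldots,n\}$. The standard simplex is $\Delta_m=\{x=(x_e)_{e\in E}\in\mathbb R^m: x_e\ge 0 \text{ for all } e\in E,\ \sum_{e\in E}x_e=1\}$. *)

(* Defs.v *)
From mathcomp Require Import all_boot all_order all_algebra.
From mathcomp Require Import classical_sets reals convex.

Set Implicit Arguments.
Unset Strict Implicit.
Unset Printing Implicit Defensive.

Import Order.TTheory GRing.Theory Num.Theory.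
Local Open Scope ring_scope.

(* E = { e \subseteq [n] : |e| = L }, with [n] rendered as 'I_n. *)
Definition edge (n L : nat) : finType := {e : {set 'I_n} | #|e| == L}.

(* R^m with coordinates indexed by E itself, so that m = #|edge n L|. The
   codomain is R^o, and not R, so that the space is canonically an R-module. *)
Definition edge_vector (R : realType) (n L : nat) : lmodType R :=
  {ffun edge n L -> R^o}.

Definition simplex (R : realType) (n L : nat) : set (edge_vector R n L) :=
  [set x : {ffun edge n L -> R^o} |
    (forall e, 0 <= x e) /\ \sum_(e : edge n L) x e = 1]%classic.

(* The sum ranges over all functions e : 'I_d -> E, that is, over E^d. *)
Definition p_poly (R : realType) (n L d : nat) (x : {ffun edge n L -> R^o})
    : R^o :=
  \sum_(e : {ffun 'I_d -> edge n L})
    (#|\bigcup_(i < d) val (e i)|%:R)^-1 * \prod_(i < d) x (e i).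

Arguments simplex : clear implicits.
Arguments p_poly : clear implicits.

(* Main.v *)
Require Import Defs.
From mathcomp Require Import all_boot all_order all_algebra.
From mathcomp Require Import ring.
From mathcomp Require Import classical_sets reals interval_inference convex.

(** The reciprocal of the cardinal of a nonempty set [U] is a nonnegative
    combination, with weights depending only on [S], of the indicators of
    [S] being disjoint from [U]. The indicator that [S] is disjoint from a union
    is the product of the indicators for its members, so [p_d(x)] becomes a
    nonnegative combination of [d]-th powers of the linear forms
    [sum of x_e over the edges e disjoint from S]. These forms are nonnegative
    on the simplex and [t ^ d] is convex for [t >= 0]. *)

Set Implicit Arguments.
Unset Strict Implicit.
Unset Printing Implicit Defensive.

Import Order.TTheory GRing.Theory Num.Theory.
Local Open Scope ring_scope.

(** Induction on [d]: once the bound for [d] is multiplied by [c], the remaining gap is [t * (1 - t)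
    * ((a - b) * (a ^+ d - b ^+ d))], and the two differences never have opposite signs. *)
Lemma convex_exprn (R : realDomainType) (a b t : R) (d : nat) :
  0 <= a -> 0 <= b -> 0 <= t <= 1 ->
  (t * a + (1 - t) * b) ^+ d <= t * a ^+ d + (1 - t) * b ^+ d.
Proof.
move=> a0 b0 /andP[t0 t1].
have s0 : 0 <= 1 - t by rewrite subr_ge0.
elim: d => [|d IHd]; first by rewrite !expr0 !mulr1 addrC subrK.
set c := t * a + (1 - t) * b in IHd *.
have c0 : 0 <= c by rewrite addr_ge0 ?mulr_ge0.
rewrite exprS; apply: le_trans (ler_wpM2l c0 IHd) _.
rewrite -subr_ge0.
have -> : t * a ^+ d.+1 + (1 - t) * b ^+ d.+1
    - c * (t * a ^+ d + (1 - t) * b ^+ d)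
  = t * (1 - t) * ((a - b) * (a ^+ d - b ^+ d)).
  by rewrite /c !exprS; ring.
apply: mulr_ge0; first exact: mulr_ge0.
case: (leP a b) => [ab|/ltW ba].
  by rewrite mulr_le0 ?subr_le0 ?lerXn2r.
by rewrite mulr_ge0 ?subr_ge0 ?lerXn2r.
Qed.

(* With [r_j = 'C(m, j) / 'C(n, j)], the [j]-th term is
   [(r_j - r_(j+1)) / (n - m)], so the sum telescopes. *)
Lemma sum_bin_ratio (F : numFieldType) (n m : nat) : (m < n)%N ->
  \sum_(0 <= j < n) 'C(m, j)%:R / ((n - j)%:R * 'C(n, j)%:R)
    = (n - m)%:R^-1 :> F.
Proof.
move=> lt_mn.
have nm0 : (n - m)%:R != 0 :> F by rewrite pnatr_eq0 subn_eq0 -ltnNge.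
pose r j : F := - ((n - m)%:R^-1 * ('C(m, j)%:R / 'C(n, j)%:R)).
rewrite (@telescope_sumr_eq _ 0 n r) // => [|j /andP[_ lt_jn]].
  by rewrite /r bin_small // !bin0 divr1 mul0r mulr0 mulr1 oppr0 add0r opprK.
have nj0 : (n - j)%:R != 0 :> F by rewrite pnatr_eq0 subn_eq0 -ltnNge.
have b0 : 'C(n, j)%:R != 0 :> F by rewrite pnatr_eq0 -lt0n bin_gt0 ltnW.
have [q q0 binS] : exists2 q : F, q != 0 &
    forall k, 'C(k, j.+1)%:R = (k - j)%:R * 'C(k, j)%:R / q.
  exists j.+1%:R => [|k]; first by rewrite pnatr_eq0.
  by rewrite -natrM -mul_bin_left natrM mulrC mulKf ?pnatr_eq0.
rewrite /r !binS.
(* For [j > m] the truncated [m - j] breaks the relation [mj] below, but then ['C(m, j) = 0] kills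
   every term. *)
have [le_jm|lt_mj] := leqP j m; last first.
  by rewrite (bin_small lt_mj) !(mul0r, mulr0) subrr.
have split : (n - j)%:R = (n - m)%:R + (m - j)%:R :> F.
  by rewrite -natrD addnBA // subnK // ltnW.
have mj : (m - j)%:R = (n - j)%:R - (n - m)%:R :> F by rewrite split addrC addKr.
rewrite mj; field.
by rewrite q0 b0 nj0 nm0.
Qed.

(* For [S = setT] the weight is [0^-1 = 0]. *)
Definition disjoint_weight (F : numFieldType) (T : finType) (S : {set T}) : F :=
  ((#|T| - #|S|)%:R * 'C(#|T|, #|S|)%:R)^-1.

Lemma disjoint_weight_ge0 (F : numFieldType) (T : finType) (S : {set T}) :
  0 <= disjoint_weight F S.
Proof. by rewrite invr_ge0 mulr_ge0 ?ler0n. Qed.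

(** Subsets of [~: U] of size [j] number ['C(#|~: U|, j)] and have equal weight, so grouping by size
    reduces to [sum_bin_ratio]. *)
Lemma sum_disjoint_weight (F : numFieldType) (T : finType) (U : {set T}) :
  U != finset.set0 ->
  \sum_(S : {set T} | [disjoint S & U]) disjoint_weight F S = #|U|%:R^-1.
Proof.
rewrite -card_gt0 => U0.
have cUC : #|U| = (#|T| - #|~: U|)%N by rewrite -(cardsC U) addnK.
have lt_UC : (#|~: U| < #|T|)%N by rewrite -(cardsC U) -[ltnLHS]add0n ltn_add2r.
rewrite [in RHS]cUC -sum_bin_ratio //.
(* The added term [j = #|T|] is zero; with it, [j] covers all sizes of subsets of [T]. *)
transitivity (\sum_(0 <= j < #|T|.+1)
    'C(#|~: U|, j)%:R / ((#|T| - j)%:R * 'C(#|T|, j)%:R) : F); last first.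
  by rewrite big_nat_recr //= (bin_small lt_UC) mul0r addr0.
rewrite big_mkord.
rewrite (partition_big (fun S : {set T} => inord #|S| : 'I_#|T|.+1) xpredT) //=.
apply: eq_bigr => j _.
rewrite -cards_draws mulrC -sumr_const.
rewrite [RHS]mulr_sumr; apply: eq_big => [S|S /andP[_ /eqP <-]].
  by rewrite inE finset.disjoints_subset -val_eqE /= inordK ?ltnS ?max_card.
by rewrite mulr1 inordK ?ltnS ?max_card.
Qed.

Lemma p_polyE (R : realType) (n L d : nat) (x : {ffun edge n L -> R^o}) :
  (0 < L)%N -> (0 < d)%N ->
  p_poly R n L d x = \sum_(S : {set 'I_n}) disjoint_weight R S *
    (\sum_(e : edge n L | [disjoint S & val e]) x e) ^+ d.
Proof.
move=> L0 d0.
have expand (S : {set 'I_n}) :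
    (\sum_(e : edge n L | [disjoint S & val e]) x e) ^+ d =
    \sum_(f : {ffun 'I_d -> edge n L} |
      [disjoint S & \bigcup_(i < d) val (f i)]) \prod_(i < d) x (f i).
  rewrite -[in LHS](card_ord d) -prodr_const bigA_distr_big.
  apply: eq_bigl => f; apply/familyP/bigcup_disjointP => disj i.
    by move=> _; exact: disj.
  exact: disj.
under [RHS]eq_bigr do rewrite expand mulr_sumr.
rewrite (exchange_big_dep xpredT) //=; apply: eq_bigr => f _.
rewrite -mulr_suml sum_disjoint_weight //.
(* The union is nonempty: it contains the edge of index 0, which has [L > 0] elements. *)
pose e := f (Ordinal d0).
have /subset_leq_card : val e \subset \bigcup_(i < d) val (f i).
  exact: (finset.bigcup_sup (Ordinal d0)).
by rewrite (eqP (valP e)) -card_gt0; apply: leq_trans.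
Qed.

Theorem mainTheorem3 (R : realType) (n L d : nat)
    (hn : (2 <= n)%N) (hL : (2 <= L)%N) (hd : (2 <= d)%N) :
  @convex_function R (edge_vector R n L) (simplex R n L) (p_poly R n L d).
Proof.
move=> t x y /set_mem[x0 _] /set_mem[y0 _].
have [L0 d0] := (ltnW hL, ltnW hd).
rewrite convRE !p_polyE // !mulr_sumr -big_split /=.
apply: ler_sum => S _.
rewrite ![_ * (disjoint_weight R S * _)]mulrCA -mulrDr.
apply: ler_wpM2l; first exact: disjoint_weight_ge0.
under eq_bigr do rewrite !ffunE.
rewrite big_split /= -!mulr_sumr.
apply: convex_exprn; rewrite ?sumr_ge0 //.
by rewrite ge0 le1.
Qed.
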